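(* The calculus D.LRC is sound with respect to perfect heterogeneous LRC-algebras: for every algebraic LRC-model based on a perfect heterogeneous LRC-algebra, every axiom of D.LRC is true in the model, and for every instance of every rule of D.LRC, if all premises are true in the model then so is the conclusion.
   Context: LANGUAGE. Fix countable disjoint sets $\mathsf{AtProp}$ and $\mathsf{AtRes}$. Resource terms: $\alpha::=a\in\mathsf{AtRes}\mid 1\mid 0\mid\alpha\cdot\alpha\mid\alpha\sqcup\alpha\mid\alpha\sqcap\alpha$. Formulas: $A::=p\in\mathsf{AtProp}\mid\top\mid\bot\mid A\vee A\mid A\wedge A\mid A\to A\mid\alpha\vartriangleright A\mid\Diamond A\mid\Diamond_r\alpha\mid\alpha\vartriangleright_r\alpha$. ALGEBRAS. A heterogeneous LRC-algebra is $F=(\mathbb{A},\mathbb{Q},\vartriangleright,\Diamond,\vartriangleright_r,\Diamond_r)$ where $\mathbb{A}$ is a Heyting algebra, $\mathbb{Q}=(Q,\sqcup,\sqcap,\cdot,0,1)$ is a bounded distributive lattice with an associative binary operation $\cdot$ preserving finite joins in each coordinate and having the lattice top $1$ as two-sided unit, and $\vartriangleright:\mathbb{Q}\times\mathbb{A}\to\mathbb{A}$, $\Diamond:\mathbb{A}\to\mathbb{A}$, $\vartriangleright_r:\mathbb{Q}\times\mathbb{Q}\to\mathbb{A}$, $\Diamond_r:\mathbb{Q}\to\mathbb{A}$ satisfy: $\Diamond$ and $\Diamond_r$ preserve finite joins (including the empty one); $\vartriangleright$ is monotone in the second coordinate, and $(\alpha\sqcup\beta)\vartriangleright u=\alpha\vartriangleright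 u\wedge\beta\vartriangleright u$, $0\vartriangleright u=\top$; $\vartriangleright_r$ turns finite joins in the first coordinate into meets and preserves finite meets in the second coordinate (including empty ones); $\alpha\vartriangleright(\beta\vartriangleright u)\le(\alpha\cdot\beta)\vartriangleright u$; $\Diamond_r\alpha\wedge\alpha\vartriangleright u\le\Diamond u$; $\alpha\vartriangleright_r\beta\le\alpha\vartriangleright\Diamond_r\beta$. It is perfect if the lattice reducts of $\mathbb{A}$ and $\mathbb{Q}$ are complete, completely distributive and completely join-generated by their completely join-irreducible elements, $\cdot$ preserves arbitrary joins in each coordinate, $\Diamond,\Diamond_r$ preserve arbitrary joins, $\vartriangleright$ turns arbitrary joins in the first coordinate into meets, and $\vartriangleright_r$ turns arbitrary joins in the first coordinate into meets and preserves arbitrary meets in the second. An algebraic LRC-model is an algebra with maps $\mathsf{AtProp}\to\mathbb{A}$, $\mathsf{AtRes}\to\mathbb{Q}$, extended homomorphically to all terms. STRUCTURES OF D.LRC. Structures are of type Fm ($X,Y,Z,W$) or Res ($\Gamma,\Delta,\Sigma,\Pi$), and occur in antecedent ($a$) or succedent ($s$) position. With $A$ ranging over formulas and $\alpha$ over resource terms: $X_a::=A\mid\mathrm{I}\mid X_a;X_a\mid X_s>X_a\mid X_a<X_s\mid\circ X_a\mid\circ_r\Gamma_a$; $X_s::=A\mid\mathrm{I}\mid X_s;X_s\mid X_a>X_s\mid X_s<X_a\mid\bullet X_s\mid\Gamma_a\,\hat{\vartriangleright}\,X_s\mid\Gamma_a\,\hat{\vartriangleright}_r\,\Gamma_s$;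 $\Gamma_a::=\alpha\mid\Phi\mid\Gamma_a\odot\Gamma_a\mid\Gamma_a,\Gamma_a\mid\Gamma_s\sqsupset\Gamma_a\mid\Gamma_a\sqsubset\Gamma_s\mid\Gamma_a\,\hat{\blacktriangle}_r\,X_a$; $\Gamma_s::=\alpha\mid\Phi\mid\Gamma_s,\Gamma_s\mid\Gamma_a\gtrdot\Gamma_s\mid\Gamma_s\lessdot\Gamma_a\mid\Gamma_a\sqsupset\Gamma_s\mid\Gamma_s\sqsubset\Gamma_a\mid\bullet_rX_s\mid X_a\,\hat{\blacktriangleright}\,X_s\mid X_a\,\hat{\blacktriangleright}_r\,\Gamma_s$. Sequents: $X_a\vdash X_s$ or $\Gamma_a\vdash\Gamma_s$ (subscripts omitted below; each rule instance must consist of such well-positioned sequents). RULES OF D.LRC (''$S/T$'': from $S$ infer $T$; ''$S\,//\,T$'': both directions). Axioms: $p\vdash p$; $a\vdash a$ (atoms). Cut: $(X\vdash Y)[A]^{succ}$, $A\vdash Z\,/\,(X\vdash Y)[Z/A]^{succ}$ (replacing an occurrence of $A$ as a substructure in succedent position); $\Gamma\vdash\alpha$, $\alpha\vdash\Delta\,/\,\Gamma\vdash\Delta$. Display Fm: $X;Y\vdash Z//Y\vdash X>Z$; $Z\vdash X;Y//X>Z\vdash Y$; $X;Y\vdash Z//X\vdash Z<Y$; $Z\vdash X;Y//Z<Y\vdash X$. Display Res: $\Gamma,\Delta\vdash\Sigma//\Delta\vdash\Gamma\sqsupset\Sigma$; $\Gamma,\Delta\vdash\Sigma//\Gamma\vdash\Sigma\sqsubset\Delta$;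 $\Gamma\vdash\Delta,\Sigma//\Delta\sqsupset\Gamma\vdash\Sigma$; $\Gamma\vdash\Delta,\Sigma//\Gamma\sqsubset\Sigma\vdash\Delta$; $\Gamma\odot\Delta\vdash\Sigma//\Delta\vdash\Gamma\gtrdot\Sigma$; $\Gamma\odot\Delta\vdash\Sigma//\Gamma\vdash\Sigma\lessdot\Delta$. Display modal: $\circ X\vdash Y//X\vdash\bullet Y$; $\circ_r\Gamma\vdash X//\Gamma\vdash\bullet_rX$; $X\vdash\Gamma\hat{\vartriangleright}Y//\Gamma\vdash X\hat{\blacktriangleright}Y$; $X\vdash\Gamma\hat{\vartriangleright}_r\Delta//\Gamma\hat{\blacktriangle}_rX\vdash\Delta$; $X\vdash\Gamma\hat{\vartriangleright}_r\Delta//\Gamma\vdash X\hat{\blacktriangleright}_r\Delta$. Structural Fm: $X\vdash Y//\mathrm{I};X\vdash Y$; $Y\vdash X//Y\vdash X;\mathrm{I}$; $Y;X\vdash Z/X;Y\vdash Z$; $Z\vdash X;Y/Z\vdash Y;X$; $Y\vdash Z/X;Y\vdash Z$; $Z\vdash Y/Z\vdash Y;X$; $X;X\vdash Y/X\vdash Y$; $Y\vdash X;X/Y\vdash X$; $X;(Y;Z)\vdash W//(X;Y);Z\vdash W$; $W\vdash(Z;Y);X//W\vdash Z;(Y;X)$. Structural Res: $\Gamma\odot\Phi\vdash\Delta//\Gamma\vdash\Delta$; $\Gamma\vdash\Delta//\Phi\odot\Gamma\vdash\Delta$; $\Gamma\vdash\Delta//\Gamma\vdash\Delta,\Phi$;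 $\Gamma\odot(\Delta\odot\Sigma)\vdash\Pi//(\Gamma\odot\Delta)\odot\Sigma\vdash\Pi$; $\Phi\vdash\Delta/\Gamma\vdash\Delta$; $\Gamma\vdash\Delta/\Gamma,\Sigma\vdash\Delta$; $\Gamma\vdash\Delta/\Gamma\vdash\Delta,\Sigma$; $\Gamma,\Gamma\vdash\Delta/\Gamma\vdash\Delta$; $\Gamma\vdash\Delta,\Delta/\Gamma\vdash\Delta$; $\Gamma,\Delta\vdash\Sigma/\Delta,\Gamma\vdash\Sigma$; $\Sigma\vdash\Gamma,\Delta/\Sigma\vdash\Delta,\Gamma$; $\Sigma,(\Delta,\Gamma)\vdash\Pi//(\Sigma,\Delta),\Gamma\vdash\Pi$; $\Pi\vdash\Sigma,(\Delta,\Gamma)//\Pi\vdash(\Sigma,\Delta),\Gamma$; $\Pi\vdash(\Gamma\gtrdot\Delta),(\Gamma\gtrdot\Sigma)/\Pi\vdash\Gamma\gtrdot(\Delta,\Sigma)$. D-rules: $X\vdash\bullet Y;\bullet Z/X\vdash\bullet(Y;Z)$; $\Gamma\vdash\bullet_rX,\bullet_rY/\Gamma\vdash\bullet_r(X;Y)$; $X\vdash\mathrm{I}/X\vdash\bullet\mathrm{I}$; $\Gamma\vdash\Phi/\Gamma\vdash\bullet_r\mathrm{I}$. B-rules: $\Gamma\vdash(Y\hat{\blacktriangleright}_r\Delta),(Z\hat{\blacktriangleright}_r\Delta)/\Gamma\vdash(Y;Z)\hat{\blacktriangleright}_r\Delta$; $\Gamma\vdash(Y\hat{\blacktriangleright}W),(Z\hat{\blacktriangleright}W)/\Gamma\vdash(Y;Z)\hat{\blacktriangleright}W$;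 $(\Gamma\hat{\blacktriangle}_rX),(\Gamma\hat{\blacktriangle}_rY)\vdash\Delta/\Gamma\hat{\blacktriangle}_r(X;Y)\vdash\Delta$; $X\vdash\Gamma\hat{\vartriangleright}(\Delta\hat{\vartriangleright}Y)/X\vdash(\Gamma\odot\Delta)\hat{\vartriangleright}Y$; $\Phi\vdash\Delta/\Gamma\hat{\blacktriangle}_r\mathrm{I}\vdash\Delta$. BD-rules: $X\vdash\Gamma\hat{\vartriangleright}\bullet Y/X\vdash\circ_r\Gamma>Y$; $X\vdash\Gamma\hat{\vartriangleright}_r\bullet_rY/X\vdash\Gamma\hat{\vartriangleright}Y$. Logical Fm: $\bot\vdash\mathrm{I}$; $X\vdash\mathrm{I}/X\vdash\bot$; $\mathrm{I}\vdash X/\top\vdash X$; $\mathrm{I}\vdash\top$; $A;B\vdash X/A\wedge B\vdash X$; $X\vdash A,\ Y\vdash B$ (two premises) $/X;Y\vdash A\wedge B$; $A\vdash X$ and $B\vdash Y/A\vee B\vdash X;Y$; $X\vdash A;B/X\vdash A\vee B$; $X\vdash A$ and $B\vdash Y/A\to B\vdash X>Y$; $X\vdash A>B/X\vdash A\to B$. Logical Res: $0\vdash\Phi$; $\Gamma\vdash\Phi/\Gamma\vdash0$; $\Phi\vdash\Gamma/1\vdash\Gamma$; $\Phi\vdash1$; $\alpha\odot\beta\vdash\Gamma/\alpha\cdot\beta\vdash\Gamma$; $\Gamma\vdash\alpha$ and $\Delta\vdash\beta/\Gamma\odot\Delta\vdash\alpha\cdot\beta$; $\alpha\vdash\Gamma$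 and $\beta\vdash\Delta/\alpha\sqcup\beta\vdash(\Gamma,\Delta)$; $\Gamma\vdash(\alpha,\beta)/\Gamma\vdash\alpha\sqcup\beta$; $(\alpha,\beta)\vdash\Gamma/\alpha\sqcap\beta\vdash\Gamma$; $\Gamma\vdash\alpha$ and $\Delta\vdash\beta/(\Gamma,\Delta)\vdash\alpha\sqcap\beta$. Logical modal: $\circ A\vdash X/\Diamond A\vdash X$; $X\vdash A/\circ X\vdash\Diamond A$; $\Gamma\vdash\alpha$ and $A\vdash X/\alpha\vartriangleright A\vdash\Gamma\hat{\vartriangleright}X$; $X\vdash\alpha\hat{\vartriangleright}A/X\vdash\alpha\vartriangleright A$; $\circ_r\alpha\vdash X/\Diamond_r\alpha\vdash X$; $\Gamma\vdash\alpha/\circ_r\Gamma\vdash\Diamond_r\alpha$; $\Gamma\vdash\alpha$ and $\beta\vdash\Delta/\alpha\vartriangleright_r\beta\vdash\Gamma\hat{\vartriangleright}_r\Delta$; $X\vdash\alpha\hat{\vartriangleright}_r\beta/X\vdash\alpha\vartriangleright_r\beta$. INTERPRETATION in a model on a perfect algebra. Antecedent position: $\mathrm{I}$ is $\top$, $;$ is $\wedge$, $X>Z$ (and $Z<X$) is the least $y$ with $Z\le X\vee y$, $\circ$ is $\Diamond$, $\circ_r$ is $\Diamond_r$, $\Phi$ is $1$, $\odot$ is $\cdot$, comma is $\sqcap$, $\Delta\sqsupset\Gamma$ (and $\Gamma\sqsubset\Delta$) is the least $y$ with $\Gamma\le\Delta\sqcup y$, and $\hat{\blacktriangle}_r$ is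 the map with $q\hat{\blacktriangle}_ru\le w\iff u\le q\vartriangleright_rw$. Succedent position: $\mathrm{I}$ is $\bot$, $;$ is $\vee$, $X>Z$ (and $Z<X$) is $X\to Z$, $\Phi$ is $0$, comma is $\sqcup$, $\hat{\vartriangleright}$ is $\vartriangleright$, $\hat{\vartriangleright}_r$ is $\vartriangleright_r$, $\Gamma\sqsupset\Sigma$ (and $\Sigma\sqsubset\Gamma$) is the greatest $y$ with $\Gamma\sqcap y\le\Sigma$, $\gtrdot,\lessdot$ are the residuals of $\cdot$ ($q\cdot w\le z\iff w\le q\gtrdot z\iff q\le z\lessdot w$), and $\bullet,\bullet_r,\hat{\blacktriangleright},\hat{\blacktriangleright}_r$ are the maps determined by $\Diamond u\le w\iff u\le\bullet w$; $\Diamond_rq\le u\iff q\le\bullet_ru$; $u\le q\vartriangleright w\iff q\le u\hat{\blacktriangleright}w$; $u\le q\vartriangleright_rw\iff q\le u\hat{\blacktriangleright}_rw$. A sequent is true in the model if the value of its left side is $\le$ the value of its right side. *)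

(* Defs.v *)
From mathcomp Require Import all_boot all_order.
From mathcomp Require Import boolp classical_sets.

Set Implicit Arguments.
Unset Strict Implicit.
Unset Printing Implicit Defensive.

Import Order.LTheory.
Local Open Scope classical_set_scope.
Local Open Scope order_scope.

Inductive res (AtRes : Type) : Type :=
| RAtom of AtRes
| ROne
| RZero
| RMul of res AtRes & res AtRes
| RJoin of res AtRes & res AtRes
| RMeet of res AtRes & res AtRes.

Arguments ROne {AtRes}.
Arguments RZero {AtRes}.

Inductive fm (AtProp AtRes : Type) : Type :=
| FAtom of AtProp
| FTop
| FBot
| FOr of fm AtProp AtRes & fm AtProp AtRes
| FAnd of fm AtProp AtRes & fm AtProp AtRes
| FImp of fm AtProp AtRes & fm AtProp AtRes
| FTri of res AtRes & fm AtProp AtRes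
| FDia of fm AtProp AtRes
| FDiar of res AtRes
| FTrir of res AtRes & res AtRes.

Arguments FAtom {AtProp AtRes}.
Arguments FTop {AtProp AtRes}.
Arguments FBot {AtProp AtRes}.
Arguments FDiar {AtProp AtRes}.
Arguments FTrir {AtProp AtRes}.

Record lrcAlgebra (dA dQ : Order.disp_t)
    (A : tbLatticeType dA) (Q : tbDistrLatticeType dQ) := LRCAlgebra {
  imp : A -> A -> A;
  rmul : Q -> Q -> Q;
  tri : Q -> A -> A;
  dia : A -> A;
  trir : Q -> Q -> A;
  diar : Q -> A;
  (* with this residuation law the bounded lattice A is a Heyting algebra *)
  impP : forall x y z, (x `&` y <= z) = (x <= imp y z);
  rmulA : associative rmul;
  rmulUl : forall x y z, rmul (x `|` y) z = rmul x z `|` rmul y z;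
  rmulUr : forall x y z, rmul x (y `|` z) = rmul x y `|` rmul x z;
  rmul0l : forall x, rmul \bot x = \bot;
  rmul0r : forall x, rmul x \bot = \bot;
  rmul1l : forall x, rmul \top x = x;
  rmul1r : forall x, rmul x \top = x;
  diaU : forall u v, dia (u `|` v) = dia u `|` dia v;
  dia0 : dia \bot = \bot;
  diarU : forall q r, diar (q `|` r) = diar q `|` diar r;
  diar0 : diar \bot = \bot;
  tri_mono : forall q u v, u <= v -> tri q u <= tri q v;
  triU : forall q r u, tri (q `|` r) u = tri q u `&` tri r u;
  tri0 : forall u, tri \bot u = \top;
  trirU : forall q r w, trir (q `|` r) w = trir q w `&` trir r w;
  trir0 : forall w, trir \bot w = \top;
  trirI : forall q w z, trir q (w `&` z) = trir q w `&` trir q z;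
  trir1 : forall q, trir q \top = \top;
  tri_mul : forall q r u, tri q (tri r u) <= tri (rmul q r) u;
  diar_tri : forall q u, diar q `&` tri q u <= dia u;
  trir_tri : forall q r, trir q r <= tri q (diar r)
}.

Section CompleteLattices.
Context {d : Order.disp_t} {L : tbLatticeType d}.

Definition complete_lattice : Prop :=
  forall S : set L, supremums S !=set0 /\ infimums S !=set0.

Definition bigjoin (S : set L) : L := supremum \bot S.
Definition bigmeet (S : set L) : L := infimum \top S.

(* The distributed join ranges over the choice functions f of the family SS. *)
Definition completely_distributive : Prop :=
  forall SS : set (set L),
    bigmeet [set bigjoin S | S in SS] =
    bigjoin [set bigmeet [set f S | S in SS] |
             f in [set f : set L -> L | forall S, SS S -> S (f S)]].

(* S may be empty, so a completely join-irreducible element is not \bot. *)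
Definition completely_join_irreducible (j : L) : Prop :=
  forall S : set L, j = bigjoin S -> S j.

Definition join_generated_by_irreducibles : Prop :=
  forall x : L, exists S : set L,
    S `<=` completely_join_irreducible /\ x = bigjoin S.

Definition perfect_lattice : Prop :=
  [/\ complete_lattice, completely_distributive
    & join_generated_by_irreducibles].

End CompleteLattices.

Arguments complete_lattice {d} L.
Arguments completely_distributive {d} L.
Arguments join_generated_by_irreducibles {d} L.
Arguments perfect_lattice {d} L.

Record perfect (dA dQ : Order.disp_t)
    (A : tbLatticeType dA) (Q : tbDistrLatticeType dQ)
    (F : lrcAlgebra A Q) : Prop := Perfect {
  perfectA : perfect_lattice A;
  perfectQ : perfect_lattice Q;
  rmul_joinl : forall (S : set Q) q,
    rmul F (bigjoin S) q = bigjoin [set rmul F s q | s in S];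
  rmul_joinr : forall (S : set Q) q,
    rmul F q (bigjoin S) = bigjoin [set rmul F q s | s in S];
  dia_join : forall S : set A,
    dia F (bigjoin S) = bigjoin [set dia F s | s in S];
  diar_join : forall S : set Q,
    diar F (bigjoin S) = bigjoin [set diar F s | s in S];
  tri_join : forall (S : set Q) u,
    tri F (bigjoin S) u = bigmeet [set tri F s u | s in S];
  trir_join : forall (S : set Q) w,
    trir F (bigjoin S) w = bigmeet [set trir F s w | s in S];
  trir_meet : forall q (S : set Q),
    trir F q (bigmeet S) = bigmeet [set trir F q s | s in S]
}.

Inductive ty := Fm | Res.
Inductive pos := Ant | Suc.
Definition flip (p : pos) : pos := if p is Ant then Suc else Ant.

(* [str t p] is the type of structures of type t well formed in position p.
   The connectives available in both positions take the position as an
   argument; >, <, sqsup and sqsub flip it on one side. *)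
Inductive str (AtProp AtRes : Type) : ty -> pos -> Type :=
| SForm : forall p, fm AtProp AtRes -> str AtProp AtRes Fm p
| SI : forall p, str AtProp AtRes Fm p
| SSemi : forall p, str AtProp AtRes Fm p -> str AtProp AtRes Fm p ->
    str AtProp AtRes Fm p
| SGt : forall p, str AtProp AtRes Fm (flip p) -> str AtProp AtRes Fm p ->
    str AtProp AtRes Fm p
| SLt : forall p, str AtProp AtRes Fm p -> str AtProp AtRes Fm (flip p) ->
    str AtProp AtRes Fm p
| SCirc : str AtProp AtRes Fm Ant -> str AtProp AtRes Fm Ant
| SCircr : str AtProp AtRes Res Ant -> str AtProp AtRes Fm Ant
| SBul : str AtProp AtRes Fm Suc -> str AtProp AtRes Fm Suc
| STri : str AtProp AtRes Res Ant -> str AtProp AtRes Fm Suc ->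
    str AtProp AtRes Fm Suc
| STrir : str AtProp AtRes Res Ant -> str AtProp AtRes Res Suc ->
    str AtProp AtRes Fm Suc
| STerm : forall p, res AtRes -> str AtProp AtRes Res p
| SPhi : forall p, str AtProp AtRes Res p
| SComma : forall p, str AtProp AtRes Res p -> str AtProp AtRes Res p ->
    str AtProp AtRes Res p
| SSqsup : forall p, str AtProp AtRes Res (flip p) -> str AtProp AtRes Res p ->
    str AtProp AtRes Res p
| SSqsub : forall p, str AtProp AtRes Res p -> str AtProp AtRes Res (flip p) ->
    str AtProp AtRes Res p
| SOdot : str AtProp AtRes Res Ant -> str AtProp AtRes Res Ant ->
    str AtProp AtRes Res Ant
| SBtr : str AtProp AtRes Res Ant -> str AtProp AtRes Fm Ant ->
    str AtProp AtRes Res Ant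
| SGtdot : str AtProp AtRes Res Ant -> str AtProp AtRes Res Suc ->
    str AtProp AtRes Res Suc
| SLtdot : str AtProp AtRes Res Suc -> str AtProp AtRes Res Ant ->
    str AtProp AtRes Res Suc
| SBulr : str AtProp AtRes Fm Suc -> str AtProp AtRes Res Suc
| SBtri : str AtProp AtRes Fm Ant -> str AtProp AtRes Fm Suc ->
    str AtProp AtRes Res Suc
| SBtrir : str AtProp AtRes Fm Ant -> str AtProp AtRes Res Suc ->
    str AtProp AtRes Res Suc.

Arguments SForm {AtProp AtRes p}.
Arguments SI {AtProp AtRes p}.
Arguments STerm {AtProp AtRes p}.
Arguments SPhi {AtProp AtRes p}.
Arguments SGt {AtProp AtRes p} & _ _.
Arguments SLt {AtProp AtRes p} & _ _.
Arguments SSqsup {AtProp AtRes p} & _ _.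
Arguments SSqsub {AtProp AtRes p} & _ _.

Inductive sequent (AtProp AtRes : Type) : Type :=
| Seq : forall t, str AtProp AtRes t Ant -> str AtProp AtRes t Suc ->
    sequent AtProp AtRes.

Declare Scope lrc_scope.
Delimit Scope lrc_scope with lrc.

Notation "X ⊢ Y" := (Seq X Y) (at level 70, no associativity) : lrc_scope.
Notation "⟨ A ⟩" := (SForm A) (at level 0, A at level 99) : lrc_scope.
Notation "⟪ a ⟫" := (STerm a) (at level 0, a at level 99) : lrc_scope.
Notation "'𝐈'" := SI (at level 0) : lrc_scope.
Notation "'Φ'" := SPhi (at level 0) : lrc_scope.
Notation "X ;; Y" := (SSemi X Y) (at level 55, no associativity) : lrc_scope.
Notation "X ≻ Y" := (SGt X Y) (at level 55, no associativity) : lrc_scope.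
Notation "X ≺ Y" := (SLt X Y) (at level 55, no associativity) : lrc_scope.
Notation "∘ X" := (SCirc X) (at level 35, X at level 35) : lrc_scope.
Notation "∘r G" := (SCircr G) (at level 35, G at level 35) : lrc_scope.
Notation "● X" := (SBul X) (at level 35, X at level 35) : lrc_scope.
Notation "G ▷ X" := (STri G X) (at level 55, no associativity) : lrc_scope.
Notation "G ▷r D" := (STrir G D) (at level 55, no associativity) : lrc_scope.
Notation "G ,, D" := (SComma G D) (at level 55, no associativity) : lrc_scope.
Notation "G ⊐ D" := (SSqsup G D) (at level 55, no associativity) : lrc_scope.
Notation "G ⊏ D" := (SSqsub G D) (at level 55, no associativity) : lrc_scope.
Notation "G ⊙ D" := (SOdot G D) (at level 55, no associativity) : lrc_scope.
Notation "G ▲r X" := (SBtr G X) (at level 55, no associativity) : lrc_scope.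
Notation "G ⋗ D" := (SGtdot G D) (at level 55, no associativity) : lrc_scope.
Notation "G ⋖ D" := (SLtdot G D) (at level 55, no associativity) : lrc_scope.
Notation "●r X" := (SBulr X) (at level 35, X at level 35) : lrc_scope.
Notation "X ▶ Y" := (SBtri X Y) (at level 55, no associativity) : lrc_scope.
Notation "X ▶r D" := (SBtrir X D) (at level 55, no associativity) : lrc_scope.

Section Calculus.
Context {AtProp AtRes : Type}.
Local Open Scope lrc_scope.

Local Notation fa := (str AtProp AtRes Fm Ant).
Local Notation fs := (str AtProp AtRes Fm Suc).
Local Notation ra := (str AtProp AtRes Res Ant).
Local Notation rs := (str AtProp AtRes Res Suc).
Local Notation form := (fm AtProp AtRes).
Local Notation term := (res AtRes).

(* [subst1 A Z S S']: S' is S with exactly one substructure occurrence of A in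
   succedent position replaced by Z. Formulas are leaves: occurrences of A as a
   proper subformula are not substructures. *)
Inductive subst1 (A : form) (Z : fs) :
    forall t p, str AtProp AtRes t p -> str AtProp AtRes t p -> Prop :=
| sb_here : subst1 A Z (SForm (p:=Suc) A) Z
| sb_semi1 p (X X' Y : str AtProp AtRes Fm p) :
    subst1 A Z X X' -> subst1 A Z (X ;; Y) (X' ;; Y)
| sb_semi2 p (X Y Y' : str AtProp AtRes Fm p) :
    subst1 A Z Y Y' -> subst1 A Z (X ;; Y) (X ;; Y')
| sb_gt1 p (X X' : str AtProp AtRes Fm (flip p)) (Y : str AtProp AtRes Fm p) :
    subst1 A Z X X' -> subst1 A Z (X ≻ Y) (X' ≻ Y)
| sb_gt2 p (X : str AtProp AtRes Fm (flip p)) (Y Y' : str AtProp AtRes Fm p) :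
    subst1 A Z Y Y' -> subst1 A Z (X ≻ Y) (X ≻ Y')
| sb_lt1 p (X X' : str AtProp AtRes Fm p) (Y : str AtProp AtRes Fm (flip p)) :
    subst1 A Z X X' -> subst1 A Z (X ≺ Y) (X' ≺ Y)
| sb_lt2 p (X : str AtProp AtRes Fm p) (Y Y' : str AtProp AtRes Fm (flip p)) :
    subst1 A Z Y Y' -> subst1 A Z (X ≺ Y) (X ≺ Y')
| sb_circ (X X' : fa) : subst1 A Z X X' -> subst1 A Z (∘ X) (∘ X')
| sb_circr (G G' : ra) : subst1 A Z G G' -> subst1 A Z (∘r G) (∘r G')
| sb_bul (X X' : fs) : subst1 A Z X X' -> subst1 A Z (● X) (● X')
| sb_tri1 (G G' : ra) (X : fs) :
    subst1 A Z G G' -> subst1 A Z (G ▷ X) (G' ▷ X)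
| sb_tri2 (G : ra) (X X' : fs) :
    subst1 A Z X X' -> subst1 A Z (G ▷ X) (G ▷ X')
| sb_trir1 (G G' : ra) (D : rs) :
    subst1 A Z G G' -> subst1 A Z (G ▷r D) (G' ▷r D)
| sb_trir2 (G : ra) (D D' : rs) :
    subst1 A Z D D' -> subst1 A Z (G ▷r D) (G ▷r D')
| sb_comma1 p (G G' D : str AtProp AtRes Res p) :
    subst1 A Z G G' -> subst1 A Z (G ,, D) (G' ,, D)
| sb_comma2 p (G D D' : str AtProp AtRes Res p) :
    subst1 A Z D D' -> subst1 A Z (G ,, D) (G ,, D')
| sb_sqsup1 p (G G' : str AtProp AtRes Res (flip p))
    (D : str AtProp AtRes Res p) :
    subst1 A Z G G' -> subst1 A Z (G ⊐ D) (G' ⊐ D)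
| sb_sqsup2 p (G : str AtProp AtRes Res (flip p))
    (D D' : str AtProp AtRes Res p) :
    subst1 A Z D D' -> subst1 A Z (G ⊐ D) (G ⊐ D')
| sb_sqsub1 p (G G' : str AtProp AtRes Res p)
    (D : str AtProp AtRes Res (flip p)) :
    subst1 A Z G G' -> subst1 A Z (G ⊏ D) (G' ⊏ D)
| sb_sqsub2 p (G : str AtProp AtRes Res p)
    (D D' : str AtProp AtRes Res (flip p)) :
    subst1 A Z D D' -> subst1 A Z (G ⊏ D) (G ⊏ D')
| sb_odot1 (G G' D : ra) : subst1 A Z G G' -> subst1 A Z (G ⊙ D) (G' ⊙ D)
| sb_odot2 (G D D' : ra) : subst1 A Z D D' -> subst1 A Z (G ⊙ D) (G ⊙ D')
| sb_btr1 (G G' : ra) (X : fa) :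
    subst1 A Z G G' -> subst1 A Z (G ▲r X) (G' ▲r X)
| sb_btr2 (G : ra) (X X' : fa) :
    subst1 A Z X X' -> subst1 A Z (G ▲r X) (G ▲r X')
| sb_gtdot1 (G G' : ra) (D : rs) :
    subst1 A Z G G' -> subst1 A Z (G ⋗ D) (G' ⋗ D)
| sb_gtdot2 (G : ra) (D D' : rs) :
    subst1 A Z D D' -> subst1 A Z (G ⋗ D) (G ⋗ D')
| sb_ltdot1 (D D' : rs) (G : ra) :
    subst1 A Z D D' -> subst1 A Z (D ⋖ G) (D' ⋖ G)
| sb_ltdot2 (D : rs) (G G' : ra) :
    subst1 A Z G G' -> subst1 A Z (D ⋖ G) (D ⋖ G')
| sb_bulr (X X' : fs) : subst1 A Z X X' -> subst1 A Z (●r X) (●r X')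
| sb_btri1 (X X' : fa) (Y : fs) :
    subst1 A Z X X' -> subst1 A Z (X ▶ Y) (X' ▶ Y)
| sb_btri2 (X : fa) (Y Y' : fs) :
    subst1 A Z Y Y' -> subst1 A Z (X ▶ Y) (X ▶ Y')
| sb_btrir1 (X X' : fa) (D : rs) :
    subst1 A Z X X' -> subst1 A Z (X ▶r D) (X' ▶r D)
| sb_btrir2 (X : fa) (D D' : rs) :
    subst1 A Z D D' -> subst1 A Z (X ▶r D) (X ▶r D').

Inductive subst1_seq (A : form) (Z : fs) :
    sequent AtProp AtRes -> sequent AtProp AtRes -> Prop :=
| sbs_left (X X' : fa) (Y : fs) :
    subst1 A Z X X' -> subst1_seq A Z (X ⊢ Y) (X' ⊢ Y)
| sbs_right (X : fa) (Y Y' : fs) :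
    subst1 A Z Y Y' -> subst1_seq A Z (X ⊢ Y) (X ⊢ Y').

(* The zero-premise rules for the logical constants are counted as axioms. *)
Inductive is_axiom : sequent AtProp AtRes -> Prop :=
| ax_prop (p : AtProp) : is_axiom (⟨FAtom p⟩ ⊢ ⟨FAtom p⟩)
| ax_res (a : AtRes) : is_axiom (⟪RAtom a⟫ ⊢ ⟪RAtom a⟫)
| ax_bot : is_axiom (⟨FBot⟩ ⊢ 𝐈)
| ax_top : is_axiom (𝐈 ⊢ ⟨FTop⟩)
| ax_zero : is_axiom (⟪RZero⟫ ⊢ Φ)
| ax_one : is_axiom (Φ ⊢ ⟪ROne⟫).

(* Invertible rules: each side may be inferred from the other. *)
Inductive birule : sequent AtProp AtRes -> sequent AtProp AtRes -> Prop :=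
| d_semi_gt_s (X Y : fa) (Z : fs) : birule (X ;; Y ⊢ Z) (Y ⊢ X ≻ Z)
| d_semi_gt_a (Z : fa) (X Y : fs) : birule (Z ⊢ X ;; Y) (X ≻ Z ⊢ Y)
| d_semi_lt_s (X Y : fa) (Z : fs) : birule (X ;; Y ⊢ Z) (X ⊢ Z ≺ Y)
| d_semi_lt_a (Z : fa) (X Y : fs) : birule (Z ⊢ X ;; Y) (Z ≺ Y ⊢ X)
| d_comma_sqsup_s (G D : ra) (S : rs) : birule (G ,, D ⊢ S) (D ⊢ G ⊐ S)
| d_comma_sqsub_s (G D : ra) (S : rs) : birule (G ,, D ⊢ S) (G ⊢ S ⊏ D)
| d_comma_sqsup_a (G : ra) (D S : rs) : birule (G ⊢ D ,, S) (D ⊐ G ⊢ S)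
| d_comma_sqsub_a (G : ra) (D S : rs) : birule (G ⊢ D ,, S) (G ⊏ S ⊢ D)
| d_odot_gtdot (G D : ra) (S : rs) : birule (G ⊙ D ⊢ S) (D ⊢ G ⋗ S)
| d_odot_ltdot (G D : ra) (S : rs) : birule (G ⊙ D ⊢ S) (G ⊢ S ⋖ D)
| d_circ (X : fa) (Y : fs) : birule (∘ X ⊢ Y) (X ⊢ ● Y)
| d_circr (G : ra) (X : fs) : birule (∘r G ⊢ X) (G ⊢ ●r X)
| d_tri (X : fa) (G : ra) (Y : fs) : birule (X ⊢ G ▷ Y) (G ⊢ X ▶ Y)
| d_trir_btr (X : fa) (G : ra) (D : rs) : birule (X ⊢ G ▷r D) (G ▲r X ⊢ D)
| d_trir_btrir (X : fa) (G : ra) (D : rs) : birule (X ⊢ G ▷r D) (G ⊢ X ▶r D)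
| s_I_l (X : fa) (Y : fs) : birule (X ⊢ Y) (𝐈 ;; X ⊢ Y)
| s_I_r (Y : fa) (X : fs) : birule (Y ⊢ X) (Y ⊢ X ;; 𝐈)
| s_assoc_l (X Y Z : fa) (W : fs) :
    birule (X ;; (Y ;; Z) ⊢ W) ((X ;; Y) ;; Z ⊢ W)
| s_assoc_r (W : fa) (X Y Z : fs) :
    birule (W ⊢ (Z ;; Y) ;; X) (W ⊢ Z ;; (Y ;; X))
| s_odot_Phi_r (G : ra) (D : rs) : birule (G ⊙ Φ ⊢ D) (G ⊢ D)
| s_odot_Phi_l (G : ra) (D : rs) : birule (G ⊢ D) (Φ ⊙ G ⊢ D)
| s_comma_Phi (G : ra) (D : rs) : birule (G ⊢ D) (G ⊢ D ,, Φ)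
| s_odot_assoc (G D S : ra) (P : rs) :
    birule (G ⊙ (D ⊙ S) ⊢ P) ((G ⊙ D) ⊙ S ⊢ P)
| s_comma_assoc_l (S D G : ra) (P : rs) :
    birule (S ,, (D ,, G) ⊢ P) ((S ,, D) ,, G ⊢ P)
| s_comma_assoc_r (P : ra) (S D G : rs) :
    birule (P ⊢ S ,, (D ,, G)) (P ⊢ (S ,, D) ,, G).

(* [rule ps c]: c may be inferred from the list of premises ps. *)
Inductive rule :
    seq (sequent AtProp AtRes) -> sequent AtProp AtRes -> Prop :=
| r_down s s' : birule s s' -> rule [:: s] s'
| r_up s s' : birule s s' -> rule [:: s'] s
| r_cut_fm (A : form) (Z : fs) s s' :
    subst1_seq A Z s s' -> rule [:: s; ⟨A⟩ ⊢ Z] s'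
| r_cut_res (G : ra) (a : term) (D : rs) :
    rule [:: G ⊢ ⟪a⟫; ⟪a⟫ ⊢ D] (G ⊢ D)
| r_exch_l (X Y : fa) (Z : fs) : rule [:: Y ;; X ⊢ Z] (X ;; Y ⊢ Z)
| r_exch_r (Z : fa) (X Y : fs) : rule [:: Z ⊢ X ;; Y] (Z ⊢ Y ;; X)
| r_weak_l (X Y : fa) (Z : fs) : rule [:: Y ⊢ Z] (X ;; Y ⊢ Z)
| r_weak_r (Z : fa) (X Y : fs) : rule [:: Z ⊢ Y] (Z ⊢ Y ;; X)
| r_contr_l (X : fa) (Y : fs) : rule [:: X ;; X ⊢ Y] (X ⊢ Y)
| r_contr_r (Y : fa) (X : fs) : rule [:: Y ⊢ X ;; X] (Y ⊢ X)
| r_Phi_weak (G : ra) (D : rs) : rule [:: Φ ⊢ D] (G ⊢ D)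
| r_rweak_l (G S : ra) (D : rs) : rule [:: G ⊢ D] (G ,, S ⊢ D)
| r_rweak_r (G : ra) (D S : rs) : rule [:: G ⊢ D] (G ⊢ D ,, S)
| r_rcontr_l (G : ra) (D : rs) : rule [:: G ,, G ⊢ D] (G ⊢ D)
| r_rcontr_r (G : ra) (D : rs) : rule [:: G ⊢ D ,, D] (G ⊢ D)
| r_rexch_l (G D : ra) (S : rs) : rule [:: G ,, D ⊢ S] (D ,, G ⊢ S)
| r_rexch_r (S : ra) (G D : rs) : rule [:: S ⊢ G ,, D] (S ⊢ D ,, G)
| r_gtdot_comma (P G : ra) (D S : rs) :
    rule [:: P ⊢ (G ⋗ D) ,, (G ⋗ S)] (P ⊢ G ⋗ (D ,, S))
| r_D_bul (X : fa) (Y Z : fs) : rule [:: X ⊢ ● Y ;; ● Z] (X ⊢ ● (Y ;; Z))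
| r_D_bulr (G : ra) (X Y : fs) :
    rule [:: G ⊢ ●r X ,, ●r Y] (G ⊢ ●r (X ;; Y))
| r_D_bul_I (X : fa) : rule [:: X ⊢ 𝐈] (X ⊢ ● 𝐈)
| r_D_bulr_I (G : ra) : rule [:: G ⊢ Φ] (G ⊢ ●r 𝐈)
| r_B_btrir (G : ra) (Y Z : fa) (D : rs) :
    rule [:: G ⊢ (Y ▶r D) ,, (Z ▶r D)] (G ⊢ (Y ;; Z) ▶r D)
| r_B_btri (G : ra) (Y Z : fa) (W : fs) :
    rule [:: G ⊢ (Y ▶ W) ,, (Z ▶ W)] (G ⊢ (Y ;; Z) ▶ W)
| r_B_btr (G : ra) (X Y : fa) (D : rs) :
    rule [:: (G ▲r X) ,, (G ▲r Y) ⊢ D] (G ▲r (X ;; Y) ⊢ D)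
| r_B_tri (X : fa) (G D : ra) (Y : fs) :
    rule [:: X ⊢ G ▷ (D ▷ Y)] (X ⊢ (G ⊙ D) ▷ Y)
| r_B_btr_I (G : ra) (D : rs) : rule [:: Φ ⊢ D] (G ▲r 𝐈 ⊢ D)
| r_BD_tri (X : fa) (G : ra) (Y : fs) :
    rule [:: X ⊢ G ▷ ● Y] (X ⊢ ∘r G ≻ Y)
| r_BD_trir (X : fa) (G : ra) (Y : fs) :
    rule [:: X ⊢ G ▷r ●r Y] (X ⊢ G ▷ Y)
| r_bot (X : fa) : rule [:: X ⊢ 𝐈] (X ⊢ ⟨FBot⟩)
| r_top (X : fs) : rule [:: 𝐈 ⊢ X] (⟨FTop⟩ ⊢ X)
| r_and_l (A B : form) (X : fs) :
    rule [:: ⟨A⟩ ;; ⟨B⟩ ⊢ X] (⟨FAnd A B⟩ ⊢ X)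
| r_and_r (X Y : fa) (A B : form) :
    rule [:: X ⊢ ⟨A⟩; Y ⊢ ⟨B⟩] (X ;; Y ⊢ ⟨FAnd A B⟩)
| r_or_l (A B : form) (X Y : fs) :
    rule [:: ⟨A⟩ ⊢ X; ⟨B⟩ ⊢ Y] (⟨FOr A B⟩ ⊢ X ;; Y)
| r_or_r (X : fa) (A B : form) :
    rule [:: X ⊢ ⟨A⟩ ;; ⟨B⟩] (X ⊢ ⟨FOr A B⟩)
| r_imp_l (X : fa) (Y : fs) (A B : form) :
    rule [:: X ⊢ ⟨A⟩; ⟨B⟩ ⊢ Y] (⟨FImp A B⟩ ⊢ X ≻ Y)
| r_imp_r (X : fa) (A B : form) :
    rule [:: X ⊢ ⟨A⟩ ≻ ⟨B⟩] (X ⊢ ⟨FImp A B⟩)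
| r_zero (G : ra) : rule [:: G ⊢ Φ] (G ⊢ ⟪RZero⟫)
| r_one (G : rs) : rule [:: Φ ⊢ G] (⟪ROne⟫ ⊢ G)
| r_mul_l (a b : term) (G : rs) :
    rule [:: ⟪a⟫ ⊙ ⟪b⟫ ⊢ G] (⟪RMul a b⟫ ⊢ G)
| r_mul_r (G D : ra) (a b : term) :
    rule [:: G ⊢ ⟪a⟫; D ⊢ ⟪b⟫] (G ⊙ D ⊢ ⟪RMul a b⟫)
| r_join_l (a b : term) (G D : rs) :
    rule [:: ⟪a⟫ ⊢ G; ⟪b⟫ ⊢ D] (⟪RJoin a b⟫ ⊢ G ,, D)
| r_join_r (G : ra) (a b : term) :
    rule [:: G ⊢ ⟪a⟫ ,, ⟪b⟫] (G ⊢ ⟪RJoin a b⟫)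
| r_meet_l (a b : term) (G : rs) :
    rule [:: ⟪a⟫ ,, ⟪b⟫ ⊢ G] (⟪RMeet a b⟫ ⊢ G)
| r_meet_r (G D : ra) (a b : term) :
    rule [:: G ⊢ ⟪a⟫; D ⊢ ⟪b⟫] (G ,, D ⊢ ⟪RMeet a b⟫)
| r_dia_l (A : form) (X : fs) : rule [:: ∘ ⟨A⟩ ⊢ X] (⟨FDia A⟩ ⊢ X)
| r_dia_r (X : fa) (A : form) : rule [:: X ⊢ ⟨A⟩] (∘ X ⊢ ⟨FDia A⟩)
| r_tri_l (G : ra) (X : fs) (a : term) (A : form) :
    rule [:: G ⊢ ⟪a⟫; ⟨A⟩ ⊢ X] (⟨FTri a A⟩ ⊢ G ▷ X)
| r_tri_r (X : fa) (a : term) (A : form) :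
    rule [:: X ⊢ ⟪a⟫ ▷ ⟨A⟩] (X ⊢ ⟨FTri a A⟩)
| r_diar_l (a : term) (X : fs) : rule [:: ∘r ⟪a⟫ ⊢ X] (⟨FDiar a⟩ ⊢ X)
| r_diar_r (G : ra) (a : term) : rule [:: G ⊢ ⟪a⟫] (∘r G ⊢ ⟨FDiar a⟩)
| r_trir_l (G : ra) (D : rs) (a b : term) :
    rule [:: G ⊢ ⟪a⟫; ⟪b⟫ ⊢ D] (⟨FTrir a b⟩ ⊢ G ▷r D)
| r_trir_r (X : fa) (a b : term) :
    rule [:: X ⊢ ⟪a⟫ ▷r ⟪b⟫] (X ⊢ ⟨FTrir a b⟩).

End Calculus.

Section Residuals.
Context {dA dQ : Order.disp_t} {A : tbLatticeType dA}
  {Q : tbDistrLatticeType dQ} (F : lrcAlgebra A Q).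

(* The operations below are definite descriptions: [xget x0 P] is an element of
   P if there is one, and otherwise the (here irrelevant) default x0. *)

Definition least {d} {L : tbLatticeType d} (P : set L) : L :=
  xget \bot (P `&` lbound P)%classic.
Definition greatest {d} {L : tbLatticeType d} (P : set L) : L :=
  xget \bot (P `&` ubound P)%classic.

Definition coimp {d} {L : tbLatticeType d} (x z : L) : L :=
  least [set y | z <= x `|` y].
Definition rimp (q r : Q) : Q := greatest [set y | q `&` y <= r].

Definition gtdot (q z : Q) : Q :=
  xget \bot [set r | forall w, (rmul F q w <= z) = (w <= r)].
Definition ltdot (z w : Q) : Q :=
  xget \bot [set r | forall q, (rmul F q w <= z) = (q <= r)].
Definition bul (w : A) : A :=
  xget \bot [set v | forall u, (dia F u <= w) = (u <= v)].
Definition bulr (u : A) : Q :=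
  xget \bot [set r | forall q, (diar F q <= u) = (q <= r)].
Definition btri (u w : A) : Q :=
  xget \bot [set r | forall q, (u <= tri F q w) = (q <= r)].
Definition btr (q : Q) (u : A) : Q :=
  xget \bot [set r | forall w, (r <= w) = (u <= trir F q w)].
Definition btrir (u : A) (w : Q) : Q :=
  xget \bot [set r | forall q, (u <= trir F q w) = (q <= r)].

End Residuals.

Section Interpretation.
Context {AtProp AtRes : Type} {dA dQ : Order.disp_t} {A : tbLatticeType dA}
  {Q : tbDistrLatticeType dQ} (F : lrcAlgebra A Q)
  (vP : AtProp -> A) (vR : AtRes -> Q).

Fixpoint res_val (a : res AtRes) : Q :=
  match a with
  | RAtom x => vR x
  | ROne => \top
  | RZero => \bot
  | RMul a b => rmul F (res_val a) (res_val b)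
  | RJoin a b => res_val a `|` res_val b
  | RMeet a b => res_val a `&` res_val b
  end.

Fixpoint fm_val (B : fm AtProp AtRes) : A :=
  match B with
  | FAtom x => vP x
  | FTop => \top
  | FBot => \bot
  | FOr B C => fm_val B `|` fm_val C
  | FAnd B C => fm_val B `&` fm_val C
  | FImp B C => imp F (fm_val B) (fm_val C)
  | FTri a B => tri F (res_val a) (fm_val B)
  | FDia B => dia F (fm_val B)
  | FDiar a => diar F (res_val a)
  | FTrir a b => trir F (res_val a) (res_val b)
  end.

Definition carrier (t : ty) : Type := match t with Fm => A | Res => Q end.

Definition carrier_le (t : ty) : carrier t -> carrier t -> Prop :=
  match t return carrier t -> carrier t -> Prop with
  | Fm => fun x y : A => x <= y
  | Res => fun x y : Q => x <= y
  end.

Fixpoint str_val t p (S : str AtProp AtRes t p) : carrier t :=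
  match S in str _ _ t _ return carrier t with
  | SForm _ B => fm_val B
  | SI Ant => (\top : A)
  | SI Suc => (\bot : A)
  | SSemi Ant X Y => (str_val X : A) `&` (str_val Y : A)
  | SSemi Suc X Y => (str_val X : A) `|` (str_val Y : A)
  | SGt Ant X Y => coimp (str_val X : A) (str_val Y : A)
  | SGt Suc X Y => imp F (str_val X) (str_val Y)
  | SLt Ant Y X => coimp (str_val X : A) (str_val Y : A)
  | SLt Suc Y X => imp F (str_val X) (str_val Y)
  | SCirc X => dia F (str_val X)
  | SCircr G => diar F (str_val G)
  | SBul X => bul F (str_val X)
  | STri G X => tri F (str_val G) (str_val X)
  | STrir G D => trir F (str_val G) (str_val D)
  | STerm _ a => res_val a
  | SPhi Ant => (\top : Q)
  | SPhi Suc => (\bot : Q)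
  | SComma Ant G D => (str_val G : Q) `&` (str_val D : Q)
  | SComma Suc G D => (str_val G : Q) `|` (str_val D : Q)
  | SSqsup Ant G D => coimp (str_val G : Q) (str_val D : Q)
  | SSqsup Suc G D => rimp (str_val G : Q) (str_val D : Q)
  | SSqsub Ant D G => coimp (str_val G : Q) (str_val D : Q)
  | SSqsub Suc D G => rimp (str_val G : Q) (str_val D : Q)
  | SOdot G D => rmul F (str_val G) (str_val D)
  | SBtr G X => btr F (str_val G) (str_val X)
  | SGtdot G D => gtdot F (str_val G) (str_val D)
  | SLtdot D G => ltdot F (str_val D) (str_val G)
  | SBulr X => bulr F (str_val X)
  | SBtri X Y => btri F (str_val X) (str_val Y)
  | SBtrir X D => btrir F (str_val X) (str_val D)
  end.

Definition holds (s : sequent AtProp AtRes) : Prop :=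
  let: Seq t X Y := s in carrier_le (str_val X) (str_val Y).

End Interpretation.

(* Main.v *)
(** Complete distributivity makes binary meets distribute over arbitrary joins
    and dually, so the (co-)implications exist; together with the preservation
    of arbitrary joins and meets this makes every structural connective a genuine
    residual. Display rules are then residuation laws, the other rules follow
    from monotonicity and the algebra axioms, and cut inside a structure is sound
    because each connective is monotone in its positive arguments and antitone
    in the others. *)
Require Import Defs.
From mathcomp Require Import all_boot all_order.
From Stdlib Require List.
From mathcomp Require Import boolp classical_sets.

Set Implicit Arguments.
Unset Strict Implicit.
Unset Printing Implicit Defensive.

Import Order.LTheory.
Local Open Scope classical_set_scope.
Local Open Scope order_scope.

(** * Joins, meets and residuals in complete and completely distributive lattices *)

Section CompleteLattice.
Context {d : Order.disp_t} {L : tbLatticeType d}.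
Hypothesis Lcomplete : complete_lattice L.

(** [supremum] returns its default in two cases: for the empty set, whose join really is [\bot], and
    when no supremum exists, which completeness excludes. The same split, with [\top] for meets,
    gives the next three lemmas. *)
Lemma bigjoin_ub (S : set L) : ubound S (bigjoin S).
Proof.
move=> x Sx; rewrite /bigjoin /supremum; case: ifPn => [/eqP S0|_].
  by move: Sx; rewrite S0.
case: xgetP => [y _ [ubS _]|]; first exact: ubS.
by case: (Lcomplete S) => -[z Sz] _ /(_ z).
Qed.

Lemma bigmeet_lb (S : set L) : lbound S (bigmeet S).
Proof.
move=> x Sx; rewrite /bigmeet /infimum; case: ifPn => [/eqP S0|_].
  by move: Sx; rewrite S0.
case: xgetP => [y _ [lbS _]|]; first exact: lbS.
by case: (Lcomplete S) => _ [z Sz] /(_ z).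
Qed.

Lemma bigjoin_le (S : set L) u : ubound S u -> bigjoin S <= u.
Proof.
move=> Su; rewrite /bigjoin /supremum; case: ifPn => [_|_]; first exact: le0x.
case: xgetP => [y _ [_]|]; first exact.
by case: (Lcomplete S) => -[x Sx] _ /(_ x).
Qed.

Lemma le_bigmeet (S : set L) u : lbound S u -> u <= bigmeet S.
Proof.
move=> Su; rewrite /bigmeet /infimum; case: ifPn => [_|_]; first exact: lex1.
case: xgetP => [y _ [_]|]; first exact.
by case: (Lcomplete S) => _ [x Sx] /(_ x).
Qed.

(** A down-closed condition that holds at the join of all its solutions is the principal down-set of
    that join, so the definite description denotes. Every right residual below is obtained by
    checking these two properties. *)
Lemma xget_right_residual (b : L -> bool) :
    (forall x y, x <= y -> b y -> b x) -> b (bigjoin [set x | b x]) ->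
  forall x, b x = (x <= xget \bot [set r | forall y, b y = (y <= r)]).
Proof.
move=> b_anti b_join.
suff /xgetPex : exists r, [set r | forall y, b y = (y <= r)] r by apply.
exists (bigjoin [set x | b x]) => y.
by apply/idP/idP => [b_y|/b_anti]; [apply: bigjoin_ub|apply].
Qed.

Lemma xget_left_residual (b : L -> bool) :
    (forall x y, x <= y -> b x -> b y) -> b (bigmeet [set x | b x]) ->
  forall x, b x = (xget \bot [set r | forall y, (r <= y) = b y] <= x).
Proof.
(* The description of [btr] has the inequality on the left of its equation, hence the reversal. *)
move=> b_mono b_meet x; apply/esym; move: x.
suff /xgetPex : exists r, [set r | forall y, (r <= y) = b y] r by apply.
exists (bigmeet [set x | b x]) => y.
by apply/idP/idP => [/b_mono|b_y]; [apply|apply: bigmeet_lb].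
Qed.

(** Same criterion for [rimp], which is described as a greatest element instead of by an
    adjunction. *)
Lemma greatest_residual (b : L -> bool) :
    (forall x y, x <= y -> b y -> b x) -> b (bigjoin [set x | b x]) ->
  forall x, b x = (x <= greatest [set y | b y]).
Proof.
move=> b_anti b_join x; have [] : ([set y | b y] `&` ubound [set y | b y])
    (greatest [set y | b y]).
  by apply: xgetPex; exists (bigjoin [set y | b y]); split=> //; apply: bigjoin_ub.
by move=> b_g ub_g; apply/idP/idP => [/ub_g//|/b_anti]; apply.
Qed.

Lemma least_residual (b : L -> bool) :
    (forall x y, x <= y -> b x -> b y) -> b (bigmeet [set x | b x]) ->
  forall x, b x = (least [set y | b y] <= x).
Proof.
move=> b_mono b_meet x; have [] : ([set y | b y] `&` lbound [set y | b y])
    (least [set y | b y]).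
  by apply: xgetPex; exists (bigmeet [set y | b y]); split=> //; apply: bigmeet_lb.
by move=> b_l lb_l; apply/idP/idP => [/lb_l//|/b_mono]; apply.
Qed.

Hypothesis Ldistr : completely_distributive L.

(* Complete distributivity for the family of all pairs {x, s}, s in S: a choice
   function either picks x once, or picks s from every pair. *)
Lemma bigmeet_join_le (x : L) (S : set L) :
  bigmeet [set x `|` s | s in S] <= x `|` bigmeet S.
Proof.
pose pair s : set L := [set x; s].
apply: (@le_trans _ _ (bigmeet [set bigjoin T | T in pair @` S])).
  apply: le_bigmeet => _ [_ [s Ss <-] <-].
  apply: (@le_trans _ _ (x `|` s)); first by apply: bigmeet_lb; exists s.
  by rewrite leUx; apply/andP; split; apply: bigjoin_ub; [left|right].
rewrite Ldistr; apply: bigjoin_le => _ [f f_choice <-].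
have [[s Ss fs]|fNx] := pselect (exists2 s, S s & f (pair s) = x).
  rewrite lexU2 //; apply/orP; left.
  by apply: bigmeet_lb; exists (pair s) => //; exists s.
rewrite lexU2 //; apply/orP; right; apply: le_bigmeet => s Ss.
apply: bigmeet_lb; exists (pair s); first by exists s.
have := f_choice (pair s); case; first by exists s.
  by move=> fs; case: fNx; exists s.
by [].
Qed.

(** Complete distributivity for the family with members {x} and [S]: a choice function must take x
    from the first and some s from [S], so its meet lies below x [&] s. *)
Lemma meet_bigjoin_le (x : L) (S : set L) :
  x `&` bigjoin S <= bigjoin [set x `&` s | s in S].
Proof.
pose SS : set (set L) := [set [set x]; S].
apply: (@le_trans _ _ (bigmeet [set bigjoin T | T in SS])).
  apply: le_bigmeet => _ [_ [->|->] <-]; last exact: leIr.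
  by apply: (le_trans (leIl _ _)); apply: bigjoin_ub.
rewrite Ldistr; apply: bigjoin_le => _ [f f_choice <-].
apply: (@le_trans _ _ (x `&` f S)).
  rewrite lexI; apply/andP; split; last by apply: bigmeet_lb; exists S; [right|].
  apply: bigmeet_lb; exists [set x]; first by left.
  by apply: (f_choice [set x]); left.
by apply: bigjoin_ub; exists (f S) => //; apply: f_choice; right.
Qed.

(** Joins distribute over arbitrary meets, so the meet of all candidates is itself a candidate. *)
Lemma coimpP (x z y : L) : (z <= x `|` y) = (coimp x z <= y).
Proof.
apply: (@least_residual (fun y => z <= x `|` y)) => [y1 y2 le_y|].
  by move/le_trans; apply; apply: leU2.
apply: le_trans (bigmeet_join_le _ _); apply: le_bigmeet => _ [y' /= ? <-] //.
Qed.

Lemma coimp_mono (x x' z z' : L) :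
  x' <= x -> z <= z' -> coimp x z <= coimp x' z'.
Proof.
move=> le_x le_z; rewrite -coimpP (le_trans le_z) //.
(* The unit of the adjunction at x', z'; monotonicity of the other residuals also reduces to a unit
   or counit. *)
by apply: (@le_trans _ _ (x' `|` coimp x' z')); [rewrite coimpP|apply: leU2].
Qed.

End CompleteLattice.

(** * Monotonicity of the operations and existence of their residuals in a perfect algebra *)

Section Residuation.
Context {dA dQ : Order.disp_t} {A : tbLatticeType dA} {Q : tbDistrLatticeType dQ}.
Context (F : lrcAlgebra A Q).

Lemma imp_mono x x' y y' : x' <= x -> y <= y' -> imp F x y <= imp F x' y'.
Proof.
move=> le_x le_y; rewrite -(impP F) (le_trans _ le_y) //.
by apply: (@le_trans _ _ (imp F x y `&` x)); [apply: leI2|rewrite (impP F)].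
Qed.

(** The larger argument is the join of the two, and [rmul] preserves binary joins in each
    coordinate. *)
Lemma rmul_mono q q' r r' : q <= q' -> r <= r' -> rmul F q r <= rmul F q' r'.
Proof.
move=> /join_idPl le_q /join_idPl le_r.
apply: (@le_trans _ _ (rmul F q' r)).
  by rewrite -le_q rmulUl leUr.
by rewrite -le_r rmulUr leUr.
Qed.

Lemma dia_mono u u' : u <= u' -> dia F u <= dia F u'.
Proof. by move=> /join_idPl <-; rewrite diaU leUr. Qed.

Lemma diar_mono q q' : q <= q' -> diar F q <= diar F q'.
Proof. by move=> /join_idPl <-; rewrite diarU leUr. Qed.

Lemma tri_monotone q q' u u' : q' <= q -> u <= u' -> tri F q u <= tri F q' u'.
Proof.
move=> /join_idPl <- le_u; rewrite triU (le_trans (leIr _ _)) //.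
exact: tri_mono.
Qed.

Lemma trir_mono q q' w w' : q' <= q -> w <= w' -> trir F q w <= trir F q' w'.
Proof.
move=> /join_idPl <- /meet_idPl <-.
by rewrite trirU !trirI; apply: (le_trans (leIr _ _)); apply: leIr.
Qed.

Hypothesis Fperf : perfect F.

Let Acomplete : complete_lattice A. Proof. by case: (perfectA Fperf). Qed.
Let Qcomplete : complete_lattice Q. Proof. by case: (perfectQ Fperf). Qed.

Lemma rimpP (q r y : Q) : (q `&` y <= r) = (y <= rimp q r).
Proof.
have [_ Qdistr _] := perfectQ Fperf.
apply: (@greatest_residual _ _ Qcomplete (fun y => q `&` y <= r)).
  move=> y1 y2 le_y.
  by apply: le_trans; apply: leI2.
apply: (le_trans (meet_bigjoin_le Qcomplete Qdistr _ _)).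
by apply: bigjoin_le => // _ [y' /= ? <-].
Qed.

Lemma rimp_mono (q q' r r' : Q) : q' <= q -> r <= r' -> rimp q r <= rimp q' r'.
Proof.
move=> le_q le_r; rewrite -rimpP (le_trans _ le_r) //.
by apply: (@le_trans _ _ (q `&` rimp q r)); [apply: leI2|rewrite rimpP].
Qed.

(** Preservation of arbitrary joins carries the inequality from all solutions to their join; the
    laws that follow differ only in the preservation clause they use. *)
Lemma gtdotP q w z : (rmul F q w <= z) = (w <= gtdot F q z).
Proof.
apply: (@xget_right_residual _ _ Qcomplete (fun w => rmul F q w <= z)).
  move=> x y le_xy.
  by apply: le_trans; apply: rmul_mono.
by rewrite rmul_joinr //; apply: bigjoin_le => // _ [y' /= ? <-].
Qed.

Lemma ltdotP q w z : (rmul F q w <= z) = (q <= ltdot F z w).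
Proof.
apply: (@xget_right_residual _ _ Qcomplete (fun q => rmul F q w <= z)).
  move=> x y le_xy.
  by apply: le_trans; apply: rmul_mono.
by rewrite rmul_joinl //; apply: bigjoin_le => // _ [y' /= ? <-].
Qed.

Lemma bulP u w : (dia F u <= w) = (u <= bul F w).
Proof.
apply: (@xget_right_residual _ _ Acomplete (fun u => dia F u <= w)).
  move=> x y le_xy.
  by apply: le_trans; apply: dia_mono.
by rewrite dia_join //; apply: bigjoin_le => // _ [y' /= ? <-].
Qed.

Lemma bulrP q u : (diar F q <= u) = (q <= bulr F u).
Proof.
apply: (@xget_right_residual _ _ Qcomplete (fun q => diar F q <= u)).
  move=> x y le_xy.
  by apply: le_trans; apply: diar_mono.
by rewrite diar_join //; apply: bigjoin_le => // _ [y' /= ? <-].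
Qed.

Lemma btriP u q w : (u <= tri F q w) = (q <= btri F u w).
Proof.
apply: (@xget_right_residual _ _ Qcomplete (fun q => u <= tri F q w)).
  move=> x y le_xy.
  by move/le_trans; apply; apply: tri_monotone.
by rewrite tri_join //; apply: le_bigmeet => // _ [y' /= ? <-].
Qed.

Lemma btrirP u q w : (u <= trir F q w) = (q <= btrir F u w).
Proof.
apply: (@xget_right_residual _ _ Qcomplete (fun q => u <= trir F q w)).
  move=> x y le_xy.
  by move/le_trans; apply; apply: trir_mono.
by rewrite trir_join //; apply: le_bigmeet => // _ [y' /= ? <-].
Qed.

(** The one left adjoint among these: it comes from [trir] preserving arbitrary meets in its second
    argument. *)
Lemma btrP u q w : (u <= trir F q w) = (btr F q u <= w).
Proof.
apply: (@xget_left_residual _ _ Qcomplete (fun w => u <= trir F q w)).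
  move=> x y le_xy.
  by move/le_trans; apply; apply: trir_mono.
by rewrite trir_meet //; apply: le_bigmeet => // _ [y' /= ? <-].
Qed.

Lemma gtdot_mono q q' z z' : q' <= q -> z <= z' -> gtdot F q z <= gtdot F q' z'.
Proof.
move=> le_q le_z; rewrite -gtdotP (le_trans _ le_z) //.
by apply: (@le_trans _ _ (rmul F q (gtdot F q z))); [exact: rmul_mono|rewrite gtdotP].
Qed.

Lemma ltdot_mono w w' z z' : w' <= w -> z <= z' -> ltdot F z w <= ltdot F z' w'.
Proof.
move=> le_w le_z; rewrite -ltdotP (le_trans _ le_z) //.
by apply: (@le_trans _ _ (rmul F (ltdot F z w) w)); [exact: rmul_mono|rewrite ltdotP].
Qed.

Lemma bul_mono w w' : w <= w' -> bul F w <= bul F w'.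
Proof. by move=> le_w; rewrite -bulP (le_trans _ le_w) // bulP. Qed.

Lemma bulr_mono u u' : u <= u' -> bulr F u <= bulr F u'.
Proof. by move=> le_u; rewrite -bulrP (le_trans _ le_u) // bulrP. Qed.

Lemma btri_mono u u' w w' : u' <= u -> w <= w' -> btri F u w <= btri F u' w'.
Proof.
move=> le_u le_w; rewrite -btriP (le_trans le_u) //.
apply: (@le_trans _ _ (tri F (btri F u w) w)); first by rewrite btriP.
exact: tri_monotone.
Qed.

Lemma btrir_mono u u' w w' : u' <= u -> w <= w' -> btrir F u w <= btrir F u' w'.
Proof.
move=> le_u le_w; rewrite -btrirP (le_trans le_u) //.
apply: (@le_trans _ _ (trir F (btrir F u w) w)); first by rewrite btrirP.
exact: trir_mono.
Qed.

Lemma btr_mono q q' u u' : q <= q' -> u <= u' -> btr F q u <= btr F q' u'.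
Proof.
move=> le_q le_u; rewrite -btrP (le_trans le_u) //.
apply: (@le_trans _ _ (trir F q' (btr F q' u'))); first by rewrite btrP.
exact: trir_mono.
Qed.

End Residuation.

(** * Soundness of cut, of the axioms and of all rules *)

Section Soundness.
Context {AtProp AtRes : Type} {dA dQ : Order.disp_t} {A : tbLatticeType dA}.
Context {Q : tbDistrLatticeType dQ} (F : lrcAlgebra A Q) (Fperf : perfect F).
Context (vP : AtProp -> A) (vR : AtRes -> Q).

Let Acomplete : complete_lattice A. Proof. by case: (perfectA Fperf). Qed.
Let Adistr : completely_distributive A. Proof. by case: (perfectA Fperf). Qed.
Let Qcomplete : complete_lattice Q. Proof. by case: (perfectQ Fperf). Qed.
Let Qdistr : completely_distributive Q. Proof. by case: (perfectQ Fperf). Qed.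

Local Notation val := (str_val F vP vR).
Local Notation true_in := (holds F vP vR).

(** Indexing the direction by the position lets a single induction on [subst1] pass through
    connectives that flip positions. *)
Definition pos_le (t : ty) (p : pos) (x y : @carrier _ _ A Q t) : Prop :=
  match p with Ant => carrier_le y x | Suc => carrier_le x y end.

(* A succedent occurrence contributes antitonically to an antecedent structure,
   so the replacement makes succedents larger and antecedents smaller. *)
Lemma subst1_pos_le B (Z : str AtProp AtRes Fm Suc) t p
    (S S' : str AtProp AtRes t p) :
  subst1 B Z S S' -> fm_val F vP vR B <= (val Z : A) ->
  pos_le p (val S) (val S').
Proof.
move=> subS leB; elim: subS => {t p S S'} //=;
  (* Connectives available in both positions are split by position, since each position has its own
     interpretation. *)
  try (match goal with |- forall p : pos, _ => case end); move=> /= *;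
  first [ exact: leI2 | exact: leU2 | exact: imp_mono
        | exact: (rimp_mono Fperf) | exact: coimp_mono
        | exact: dia_mono | exact: diar_mono | exact: bul_mono
        | exact: bulr_mono | exact: tri_monotone | exact: trir_mono
        | exact: rmul_mono | exact: btr_mono | exact: gtdot_mono
        | exact: ltdot_mono | exact: btri_mono | exact: btrir_mono ].
Qed.

(** The replacement shrinks the left side or enlarges the right side of the sequent, and either
    change preserves truth. *)
Lemma subst1_seq_sound B (Z : str AtProp AtRes Fm Suc) s s' :
  subst1_seq B Z s s' -> true_in s -> true_in (⟨B⟩ ⊢ Z)%lrc -> true_in s'.
Proof.
case=> [X X' Y|X Y Y'] /subst1_pos_le sub /= leXY /sub /=.
  by move/le_trans; apply.
exact: le_trans.
Qed.

Lemma axiom_sound (s : sequent AtProp AtRes) : is_axiom s -> true_in s.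
Proof. by case=> * /=; exact: lexx. Qed.

(** The residuation laws are boolean equations, so one rewrite serves both directions. Commutations
    bring the displayed argument to the side its law expects: left for [impP], right for [rimpP] and
    [coimpP]. *)
Lemma birule_sound (s s' : sequent AtProp AtRes) :
  birule s s' -> true_in s <-> true_in s'.
Proof.
case=> /=.
- by move=> X Y Z; rewrite meetC (impP F).
- by move=> Z X Y; rewrite coimpP.
- by move=> X Y Z; rewrite (impP F).
- by move=> Z X Y; rewrite joinC coimpP.
- by move=> G D S; rewrite (rimpP Fperf).
- by move=> G D S; rewrite meetC (rimpP Fperf).
- by move=> G D S; rewrite coimpP.
- by move=> G D S; rewrite joinC coimpP.
- by move=> G D S; rewrite (gtdotP Fperf).
- by move=> G D S; rewrite (ltdotP Fperf).
- by move=> X Y; rewrite (bulP Fperf).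
- by move=> G X; rewrite (bulrP Fperf).
- by move=> X G Y; rewrite (btriP Fperf).
- by move=> X G D; rewrite (btrP Fperf).
- by move=> X G D; rewrite (btrirP Fperf).
- by move=> X Y; rewrite meet1x.
- by move=> Y X; rewrite joinx0.
- by move=> X Y Z W; rewrite meetA.
- by move=> W X Y Z; rewrite joinA.
- by move=> G D; rewrite rmul1r.
- by move=> G D; rewrite rmul1l.
- by move=> G D; rewrite joinx0.
- by move=> G D S P; rewrite rmulA.
- by move=> S D G P; rewrite meetA.
- by move=> P S D G; rewrite joinA.
Qed.

Lemma rule_sound (ps : seq (sequent AtProp AtRes)) c :
  rule ps c -> List.Forall true_in ps -> true_in c.
Proof.
have forall1 s : List.Forall true_in [:: s] -> true_in s.
  by move=> h; inversion h.
have forall2 s s' : List.Forall true_in [:: s; s'] -> true_in s /\ true_in s'.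
  by move=> h; inversion h as [|? ? ? h']; inversion h'.
case.
- by move=> s s' ss' /forall1 /(birule_sound ss').
- by move=> s s' ss' /forall1 /(birule_sound ss').
- by move=> B Z s s' sub /forall2[]; apply: subst1_seq_sound sub.
- by move=> G a D /forall2[/= ]; apply: le_trans.
- by move=> X Y Z /forall1 /=; rewrite meetC.
- by move=> Z X Y /forall1 /=; rewrite joinC.
- by move=> X Y Z /forall1 /=; apply: le_trans; apply: leIr.
- by move=> Z X Y /forall1 /= /le_trans; apply; apply: leUl.
- by move=> X Y /forall1 /=; rewrite meetxx.
- by move=> Y X /forall1 /=; rewrite joinxx.
(* In antecedent position [Φ] is the lattice top, so every [G] lies below it. *)
- by move=> G D /forall1 /=; apply: le_trans; apply: lex1.
- by move=> G S D /forall1 /=; apply: le_trans; apply: leIl.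
- by move=> G D S /forall1 /= /le_trans; apply; apply: leUl.
- by move=> G D /forall1 /=; rewrite meetxx.
- by move=> G D /forall1 /=; rewrite joinxx.
- by move=> G D S /forall1 /=; rewrite meetC.
- by move=> S G D /forall1 /=; rewrite joinC.
(* Here and in the distribution rules for [●], [●r], [▶r], [▶] and [▲r], each half is compared
   separately by monotonicity or antitonicity. *)
- move=> P G D S /forall1 /= /le_trans; apply; rewrite leUx.
  by rewrite !gtdot_mono ?leUl ?leUr.
- move=> X Y Z /forall1 /= /le_trans; apply; rewrite leUx.
  by rewrite !bul_mono ?leUl ?leUr.
- move=> G X Y /forall1 /= /le_trans; apply; rewrite leUx.
  by rewrite !bulr_mono ?leUl ?leUr.
- by move=> X /forall1 /= /le_trans; apply; apply: le0x.
- by move=> G /forall1 /= /le_trans; apply; apply: le0x.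
- move=> G Y Z D /forall1 /= /le_trans; apply; rewrite leUx.
  by rewrite !btrir_mono ?leIl ?leIr.
- move=> G Y Z W /forall1 /= /le_trans; apply; rewrite leUx.
  by rewrite !btri_mono ?leIl ?leIr.
- move=> G X Y D /forall1 /=; apply: le_trans; rewrite lexI.
  by rewrite !btr_mono ?leIl ?leIr.
- by move=> X G D Y /forall1 /= /le_trans; apply; apply: tri_mul.
- by move=> G D /forall1 /=; apply: le_trans; apply: lex1.
- move=> X G Y /forall1 /= leX; rewrite -(impP F) meetC.
  (* The axiom [diar_tri] is taken at [bul F (val Y)], and the counit of [dia] and [bul] then leads
     down to [val Y]. *)
  apply: (@le_trans _ _ (dia F (bul F (val Y)))); last by rewrite (bulP Fperf).
  by apply: le_trans (diar_tri F _ _); apply: leI2 leX.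
(* Likewise [trir_tri] at [bulr F (val Y)], then the counit of [diar] and [bulr] under [tri]. *)
- move=> X G Y /forall1 /= /le_trans; apply; apply: (le_trans (trir_tri F _ _)).
  by apply: tri_mono; rewrite (bulrP Fperf).
- by move=> X /forall1.
- by move=> X /forall1.
- by move=> B C X /forall1.
- by move=> X Y B C /forall2[/= leX leY]; apply: leI2.
- by move=> B C X Y /forall2[/= leX leY]; apply: leU2.
- by move=> X B C /forall1.
- by move=> X Y B C /forall2[/= leX leY]; apply: imp_mono.
- by move=> X B C /forall1.
- by move=> G /forall1.
- by move=> G /forall1.
- by move=> a b G /forall1.
- by move=> G D a b /forall2[/= leG leD]; apply: rmul_mono.
- by move=> a b G D /forall2[/= leG leD]; apply: leU2.
- by move=> G a b /forall1.
- by move=> a b G /forall1.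
- by move=> G D a b /forall2[/= leG leD]; apply: leI2.
- by move=> B X /forall1.
- by move=> X B /forall1 /=; apply: dia_mono.
- by move=> G X a B /forall2[/= leG leX]; apply: tri_monotone.
- by move=> X a B /forall1.
- by move=> a X /forall1.
- by move=> G a /forall1 /=; apply: diar_mono.
- by move=> G D a b /forall2[/= leG leD]; apply: trir_mono.
- by move=> X a b /forall1.
Qed.

End Soundness.

Theorem mainTheorem4 (AtProp AtRes : countType) (dA dQ : Order.disp_t)
    (A : tbLatticeType dA) (Q : tbDistrLatticeType dQ) (F : lrcAlgebra A Q)
    (Fperf : perfect F) (vP : AtProp -> A) (vR : AtRes -> Q) :
  (forall s : sequent AtProp AtRes, is_axiom s -> holds F vP vR s) /\
  (forall (ps : seq (sequent AtProp AtRes)) (c : sequent AtProp AtRes),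
     rule ps c -> List.Forall (holds F vP vR) ps -> holds F vP vR c).
Proof.
by split; [apply: axiom_sound|apply: rule_sound].
Qed.
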